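(* Let $A$ be a left weakly Gorenstein Artin algebra. If $\phi:X\to Y$ is a homomorphism of finitely generated left $A$-modules such that $\operatorname{Hom}_A(\phi,A):\operatorname{Hom}_A(Y,A)\to\operatorname{Hom}_A(X,A)$ is an epimorphism and $\operatorname{Ext}^i_A(\phi,A):\operatorname{Ext}^i_A(Y,A)\to\operatorname{Ext}^i_A(X,A)$ is an isomorphism for every $i\ge1$, then $\phi$ is a monomorphism and $\operatorname{Coker}\phi$ is a Gorenstein-projective $A$-module.
   Context: All modules are finitely generated. A left $A$-module $M$ is semi-Gorenstein-projective if $\operatorname{Ext}^i_A(M,A)=0$ for all $i\ge 1$. A left $A$-module $G$ is Gorenstein-projective if there is an acyclic complex $P^\bullet:\cdots\to P^{-1}\to P^0\xrightarrow{d_0}P^1\to\cdots$ of finitely generated projective left $A$-modules such that $\operatorname{Hom}_A(P^\bullet,P)$ is acyclic for every finitely generated projective $P$, and $G\cong\operatorname{Ker}d_0$. The algebra $A$ is left weakly Gorenstein if every semi-Gorenstein-projective left $A$-module is Gorenstein-projective. *)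

(* Defs.v *)
From HB Require Import structures.
From mathcomp Require Import all_boot all_algebra.
From mathcomp Require Import boolp classical_sets functions cardinality fsbigop.

Set Implicit Arguments.
Unset Strict Implicit.
Unset Printing Implicit Defensive.

Import GRing.Theory.
Local Open Scope ring_scope.

(* Left A-modules are [lmodType A]. Rings are [pzRingType], so that the zero
   ring is allowed. *)

Definition artinian (R : comPzRingType) : Prop :=
  forall I : nat -> {pred R^o},
    (forall n, submod_closed (I n)) ->
    (forall n, {subset I n.+1 <= I n}) ->
    exists n, forall m, (n <= m)%N -> I m =i I n.

(* The R-algebra structure is given by a ring morphism from R to the centre of
   A; [algType R] would exclude the zero algebra. *)
Definition artin_algebra (A : pzRingType) : Prop :=
  exists (R : comPzRingType) (eta : {rmorphism R -> A}),
    [/\ artinian R,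
        forall r a, eta r * a = a * eta r
      & exists s : seq A, forall a, exists c : 'I_(size s) -> R,
          a = \sum_(i < size s) eta (c i) * s`_i].

Section Modules.
Variable A : pzRingType.

Definition fin_gen (M : lmodType A) : Prop :=
  exists s : seq M, forall x, exists c : 'I_(size s) -> A,
    x = \sum_(i < size s) c i *: s`_i.

Definition surj (T U : Type) (f : T -> U) : Prop :=
  forall y, exists x, f x = y.

Definition projective (P : lmodType A) : Prop :=
  forall (M N : lmodType A) (p : {linear M -> N}) (f : {linear P -> N}),
    surj p -> exists g : {linear P -> M}, p \o g =1 f.

Definition exact_at (U V W : zmodType) (f : U -> V) (g : V -> W) : Prop :=
  forall y, g y = 0 <-> exists x, f x = y.

Definition isomorphic (M N : lmodType A) : Prop :=
  exists f : {linear M -> N}, bijective f.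

End Modules.

Section Hom.
Variables (A : pzRingType) (M N : lmodType A).

HB.instance Definition _ := gen_eqMixin {linear M -> N}.
HB.instance Definition _ := gen_choiceMixin {linear M -> N}.

Lemma linear_ext (f g : {linear M -> N}) : f =1 g -> f = g.
Proof.
case: f g => [f [[af] [sf]]] [g [[ag] [sg]]] /= /funext fg.
by subst g; do ?congr GRing.Linear.Pack;
  rewrite (Prop_irrelevance af ag) (Prop_irrelevance sf sg).
Qed.

Definition hom_zero : {linear M -> N} := \0.
Definition hom_opp (f : {linear M -> N}) : {linear M -> N} := \- f.
Definition hom_add (f g : {linear M -> N}) : {linear M -> N} := f \+ g.

Lemma hom_addA : associative hom_add.
Proof. by move=> f g h; apply: linear_ext => x /=; rewrite addrA. Qed.
Lemma hom_addC : commutative hom_add.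
Proof. by move=> f g; apply: linear_ext => x /=; rewrite addrC. Qed.
Lemma hom_add0 : left_id hom_zero hom_add.
Proof. by move=> f; apply: linear_ext => x /=; rewrite add0r. Qed.
Lemma hom_addN : left_inverse hom_zero hom_opp hom_add.
Proof. by move=> f; apply: linear_ext => x /=; rewrite addNr. Qed.

HB.instance Definition _ := GRing.isZmodule.Build {linear M -> N}
  hom_addA hom_addC hom_add0 hom_addN.
End Hom.

Section HomPre.
Variables (A : pzRingType) (M M' : lmodType A) (f : {linear M -> M'}).
Variable (N : lmodType A).

Definition hom_pre (g : {linear M' -> N}) : {linear M -> N} := g \o f.

Lemma hom_pre_is_zmod_morphism : zmod_morphism hom_pre.
Proof. by move=> g h; apply: linear_ext. Qed.
HB.instance Definition _ := GRing.isZmodMorphism.Build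
  {linear M' -> N} {linear M -> N} hom_pre hom_pre_is_zmod_morphism.
End HomPre.
Arguments hom_pre {A M M'} f N g.

Section KerCoker.
Variables (A : pzRingType) (M N : lmodType A) (f : {linear M -> N}).

Definition kerp : {pred M} := fun x => f x == 0.
Lemma kerp_submod : submod_closed kerp.
Proof.
split=> [|a x y]; rewrite !unfold_in ?linear0 // => /eqP fx /eqP fy.
by rewrite linearP fx fy scaler0 addr0.
Qed.
HB.instance Definition _ := GRing.isSubmodClosed.Build A M kerp kerp_submod.

Definition Ker := {x : M | x \in kerp}.
HB.instance Definition _ := SubChoice.on Ker.
HB.instance Definition _ := [SubChoice_isSubLmodule of Ker by <:].

Definition imp : {pred N} := fun y => `[< exists x, f x = y >].
Lemma imp_submod : submod_closed imp.
Proof.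
split=> [|a u v]; rewrite !unfold_in; first by apply/asboolP; exists 0; rewrite linear0.
move=> /asboolP[x <-] /asboolP[y <-]; apply/asboolP.
by exists (a *: x + y); rewrite linearP.
Qed.
HB.instance Definition _ := GRing.isSubmodClosed.Build A N imp imp_submod.

Definition Coker := Quotient.quot imp.
HB.instance Definition _ := GRing.Zmodule.on Coker.

Definition coker_pi (y : N) : Coker := \pi_Coker%qT y.
Definition coker_scale (a : A) (q : Coker) : Coker := coker_pi (a *: repr q).

Lemma coker_piE y z : (coker_pi y == coker_pi z) = (y - z \in imp).
Proof. by rewrite Quotient.idealrBE. Qed.

Lemma coker_piD y z : coker_pi (y + z) = coker_pi y + coker_pi z.
Proof. by rewrite /coker_pi [RHS]piE. Qed.

Lemma coker_piZ a y : coker_pi (a *: y) = coker_scale a (coker_pi y).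
Proof.
apply/eqP; rewrite coker_piE -scalerBr rpredZ // -coker_piE.
by rewrite /coker_pi reprK.
Qed.

Lemma coker_reprK (q : Coker) : coker_pi (repr q) = q.
Proof. exact: reprK. Qed.

Fact coker_scaleA a b q : coker_scale a (coker_scale b q) = coker_scale (a * b) q.
Proof. by rewrite -[q]coker_reprK -!coker_piZ scalerA. Qed.
Fact coker_scale1 : left_id 1 coker_scale.
Proof. by move=> q; rewrite -[q]coker_reprK -coker_piZ scale1r. Qed.
Fact coker_scaleDr : right_distributive coker_scale +%R.
Proof.
move=> a q r; rewrite -[q]coker_reprK -[r]coker_reprK -coker_piD -!coker_piZ.
by rewrite scalerDr coker_piD.
Qed.
Fact coker_scaleDl q : {morph coker_scale^~ q : a b / a + b}.
Proof.
by move=> a b; rewrite -[q]coker_reprK -!coker_piZ scalerDl coker_piD.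
Qed.
HB.instance Definition _ := GRing.Zmodule_isLmodule.Build A Coker
  coker_scaleA coker_scale1 coker_scaleDr coker_scaleDl.

End KerCoker.

Section Free.
Variables (A : pzRingType) (T : choiceType).

Definition finsuppp : {pred T -> A^o} :=
  fun f => `[< finite_set [set t | f t != 0] >].
Lemma finsuppp_submod : submod_closed finsuppp.
Proof.
split=> [|a f g]; rewrite !unfold_in.
  apply/asboolP; apply: (sub_finite_set _ (finite_set0 T)) => t /=.
  by rewrite eqxx.
move=> /asboolP finf /asboolP fing; apply/asboolP.
apply: (@sub_finite_set _ _ ([set t | f t != 0] `|` [set t | g t != 0])%classic);
  last by rewrite finite_setU.
move=> t /= nz; have [ft0|] := eqVneq (f t) 0; last by left.
right; apply: contra_neq nz => gt0.
have -> : (a *: f + g) t = a *: f t + g t by [].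
by rewrite ft0 gt0 scaler0 addr0.
Qed.
HB.instance Definition _ :=
  GRing.isSubmodClosed.Build A (T -> A^o) finsuppp finsuppp_submod.

(* The free module with basis T, as the finitely supported functions T -> A. *)
Definition Free := {f : T -> A^o | f \in finsuppp}.
HB.instance Definition _ := SubChoice.on Free.
HB.instance Definition _ := [SubChoice_isSubLmodule of Free by <:].

Lemma finsupp_delta (t : T) : (fun u => (u == t)%:R : A^o) \in finsuppp.
Proof.
rewrite unfold_in; apply/asboolP.
apply: (sub_finite_set _ (finite_set1 t)) => u /=.
by have [->//|] := eqVneq u t; rewrite eqxx.
Qed.
Definition free_gen (t : T) : Free :=
  exist (fun f => f \in finsuppp) _ (finsupp_delta t).

Section Lift.
Variables (M : lmodType A) (g : T -> M).

Definition free_lift (f : Free) : M :=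
  (\sum_(t \in [set: T]) (val f t : A) *: g t)%classic.

Lemma free_liftE (f : Free) (s : seq T) : uniq s ->
  (forall t, val f t != 0 -> t \in s) ->
  free_lift f = \sum_(t <- s) (val f t : A) *: g t.
Proof.
move=> us fs; rewrite /free_lift (fsbigE s) //.
  by under eq_bigl do rewrite in_setT.
move=> t _ nts; have [->|/fs] := eqVneq (val f t) 0; first exact: scale0r.
by rewrite (negPf nts).
Qed.

Lemma free_suppP (f : Free) : exists s : seq T, forall t, val f t != 0 -> t \in s.
Proof.
case: f => f /=; rewrite unfold_in => /asboolP/finite_seqP[s sE].
by exists s => t ht; have : [set` s]%classic t by rewrite -sE.
Qed.

Lemma free_lift_is_linear : linear free_lift.
Proof.
move=> a f h; have [s sP] := free_suppP f; have [r rP] := free_suppP h.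
pose u := undup (s ++ r).
have uf t : val f t != 0 -> t \in u by rewrite mem_undup mem_cat => /sP->.
have uh t : val h t != 0 -> t \in u by rewrite mem_undup mem_cat orbC => /rP->.
rewrite !(@free_liftE _ u) ?undup_uniq //.
  rewrite scaler_sumr -big_split; apply: eq_bigr => t _ /=.
  by rewrite scalerA -scalerDl.
move=> t; apply: contraTT => ntu.
have -> : val (a *: f + h) t = a * val f t + val h t by [].
have /eqP-> : val f t == 0 by apply: contraNT ntu; apply: uf.
have /eqP-> : val h t == 0 by apply: contraNT ntu; apply: uh.
by rewrite mulr0 addr0 eqxx.
Qed.
HB.instance Definition _ :=
  GRing.isLinear.Build A Free M *:%R free_lift free_lift_is_linear.

Lemma free_lift_gen t : free_lift (free_gen t) = g t.
Proof.
rewrite (@free_liftE _ [:: t]) //; last first.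
  by move=> u /=; rewrite inE; case: (u == t) => //; rewrite eqxx.
by rewrite big_seq1 /= eqxx scale1r.
Qed.
End Lift.

Lemma free_genE (f : Free) : free_lift free_gen f = f.
Proof.
have [s sP] := free_suppP f.
rewrite (@free_liftE _ _ _ (undup s)) ?undup_uniq //; last first.
  by move=> t /sP; rewrite mem_undup.
apply: val_inj; rewrite linear_sum; apply/funext => u /=.
rewrite fct_sumE.
transitivity (\sum_(t <- undup s) (val f t : A) * (u == t)%:R : A).
  by apply: eq_bigr.
have [us|nus] := boolP (u \in undup s).
  rewrite (bigD1_seq u) ?undup_uniq //= eqxx mulr1 big1 ?addr0 // => t tu.
  by rewrite eq_sym (negPf tu) mulr0.
rewrite big1_seq => [|t /= ts].
  by apply/esym/eqP; apply: contraNT nus => /sP; rewrite mem_undup.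
by have [ut|] := eqVneq u t; rewrite ?mulr0 //; rewrite ut ts in nus.
Qed.

Lemma free_ext (M : lmodType A) (p q : {linear Free -> M}) :
  (forall t, p (free_gen t) = q (free_gen t)) -> p =1 q.
Proof.
move=> pq f; rewrite -[f]free_genE.
have [s sP] := free_suppP f.
rewrite (@free_liftE _ _ _ (undup s)) ?undup_uniq //; last first.
  by move=> t /sP; rewrite mem_undup.
by rewrite !linear_sum; apply: eq_bigr => t _; rewrite !linearZ /= pq.
Qed.

Lemma free_projective : projective Free.
Proof.
move=> M N p f psurj.
have /choice[g gP] : forall t, exists x, p x = f (free_gen t) by move=> t.
exists (free_lift g); apply: (@free_ext _ (p \o free_lift g) f) => t /=.
by rewrite free_lift_gen.
Qed.

End Free.

Section FreeMap.
Variables (A : pzRingType) (T U : choiceType) (h : T -> U).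
Definition free_map : {linear Free A T -> Free A U} :=
  free_lift (fun t => free_gen A (h t)).
End FreeMap.

Section StandardResolution.
Variable A : pzRingType.

(* The augmentation of the free module on the set of elements of M. *)
Definition aug (M : lmodType A) : {linear Free A M -> M} := free_lift id.

Fixpoint syz (n : nat) (M : lmodType A) : lmodType A :=
  if n is n'.+1 then Ker (aug (syz n' M)) else M.

(* ... -> res 2 M -> res 1 M -> res 0 M -> M -> 0 *)
Definition res (n : nat) (M : lmodType A) : lmodType A := Free A (syz n M).

Definition res_d (n : nat) (M : lmodType A) :
    {linear res n.+1 M -> res n M} :=
  (val : {linear Ker (aug (syz n M)) -> res n M}) \o aug (syz n.+1 M).

Lemma aug_gen (M : lmodType A) (x : M) : aug M (free_gen A x) = x.
Proof. exact: free_lift_gen. Qed.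

Lemma res_projective n M : projective (res n M).
Proof. exact: free_projective. Qed.

Lemma aug_surj M : surj (aug M).
Proof. by move=> x; exists (free_gen A x); rewrite aug_gen. Qed.

Lemma exact_res0 M : exact_at (res_d 0 M) (aug M).
Proof.
move=> y; split=> [y0|[x <-]]; last by apply/eqP; exact: (valP (aug _ x)).
have ky : y \in kerp (aug M) by rewrite unfold_in y0.
by have [x xE] := aug_surj (exist _ y ky : syz 1 M); exists x; rewrite /= xE.
Qed.

Lemma exact_res n M : exact_at (res_d n.+1 M) (res_d n M).
Proof.
move=> y; split=> [y0|[x <-]].
  have ky : y \in kerp (aug (syz n.+1 M)).
    by rewrite unfold_in; apply/eqP/val_inj.
  by have [x xE] := aug_surj (exist _ y ky : syz n.+2 M); exists x; rewrite /= xE.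
have /eqP kx := valP (aug (syz n.+2 M) x).
by rewrite /= kx.
Qed.

Section Functoriality.
Variables (M M' : lmodType A) (phi : {linear M -> M'}).

Lemma free_map_aug (f : Free A M) : aug M' (free_map A phi f) = phi (aug M f).
Proof.
apply: (@free_ext _ _ _ (aug M' \o free_map A phi) (phi \o aug M)) => x /=.
by rewrite /free_map free_lift_gen !aug_gen.
Qed.

Fact ker_map_subproof (k : Ker (aug M)) :
  free_map A phi (val k) \in kerp (aug M').
Proof. by rewrite unfold_in free_map_aug (eqP (valP k)) linear0. Qed.

Definition ker_map (k : Ker (aug M)) : Ker (aug M') :=
  exist (fun y => y \in kerp (aug M')) _ (ker_map_subproof k).

Lemma ker_map_is_linear : linear ker_map.
Proof. by move=> a k l; apply: val_inj; rewrite /= linearP. Qed.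
HB.instance Definition _ := GRing.isLinear.Build A
  (Ker (aug M)) (Ker (aug M')) *:%R ker_map ker_map_is_linear.
End Functoriality.

Fixpoint syz_map (n : nat) (M M' : lmodType A) (phi : {linear M -> M'}) :
    {linear syz n M -> syz n M'} :=
  match n with
  | 0 => phi
  | n'.+1 => ker_map (syz_map n' phi)
  end.

Definition res_map (n : nat) (M M' : lmodType A) (phi : {linear M -> M'}) :
    {linear res n M -> res n M'} := free_map A (syz_map n phi).

Lemma res_map_aug (M M' : lmodType A) (phi : {linear M -> M'}) x :
  aug M' (res_map 0 phi x) = phi (aug M x).
Proof. exact: free_map_aug. Qed.

Lemma res_map_d n (M M' : lmodType A) (phi : {linear M -> M'}) x :
  res_d n M' (res_map n.+1 phi x) = res_map n phi (res_d n M x).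
Proof. by rewrite /= free_map_aug. Qed.

End StandardResolution.

Section Ext.
Variables (A : pzRingType) (i : nat).

Section Group.
Variables M N : lmodType A.

Definition cocyclep : {pred {linear res i M -> N}} :=
  fun g => hom_pre (res_d i M) N g == 0.
Lemma cocyclep_zmod : zmod_closed cocyclep.
Proof.
split=> [|g h]; rewrite !unfold_in ?raddf0 // => /eqP g0 /eqP h0.
by rewrite raddfB /= g0 h0 subr0.
Qed.
HB.instance Definition _ := GRing.isZmodClosed.Build
  {linear res i M -> N} cocyclep cocyclep_zmod.

Definition Cocycle := {g : {linear res i M -> N} | g \in cocyclep}.
HB.instance Definition _ := SubChoice.on Cocycle.
HB.instance Definition _ := [SubChoice_isSubZmodule of Cocycle by <:].
End Group.
End Ext.
Arguments cocyclep {A} i M N _.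

Definition is_coboundary (A : pzRingType) (i : nat) (M N : lmodType A) :
    {linear res i M -> N} -> Prop :=
  match i with
  | 0 => fun g => g = 0
  | j.+1 => fun g => exists h, hom_pre (res_d j M) N h = g
  end.

Section ExtGroup.
Variables (A : pzRingType) (i : nat) (M N : lmodType A).

Definition coboundaryp : {pred Cocycle i M N} :=
  fun g => `[< is_coboundary (val g) >].
Lemma coboundaryp_zmod : zmod_closed coboundaryp.
Proof.
rewrite /coboundaryp; split=> [|g h]; rewrite !unfold_in.
  by apply/asboolP; case: (i) => [|j] //=; exists 0; rewrite raddf0.
move=> /asboolP bg /asboolP bh; apply/asboolP; move: g h bg bh.
case: (i) => [|j] g h /=; first by move=> g0 h0; rewrite g0 h0 subr0.
by move=> [g' <-] [h' <-]; exists (g' - h'); rewrite raddfB.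
Qed.
HB.instance Definition _ := GRing.isZmodClosed.Build
  (Cocycle i M N) coboundaryp coboundaryp_zmod.

(* Ext^i_A(M, N) = H^i(Hom_A(res M, N)) *)
Definition Ext := Quotient.quot coboundaryp.
HB.instance Definition _ := GRing.Zmodule.on Ext.

Definition ext_class (g : Cocycle i M N) : Ext := \pi_Ext%qT g.
End ExtGroup.
Arguments coboundaryp {A} i M N _.

Section ExtMap.
Variables (A : pzRingType) (i : nat) (M M' : lmodType A).
Variables (phi : {linear M -> M'}) (N : lmodType A).

Fact cocycle_map_subproof (g : Cocycle i M' N) :
  hom_pre (res_map i phi) N (val g) \in cocyclep i M N.
Proof.
rewrite unfold_in; apply/eqP/linear_ext => x /=.
have := valP g; rewrite unfold_in => /eqP g0.
have := congr1 (fun h : {linear _ -> _} => h (res_map i.+1 phi x)) g0.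
by rewrite /hom_pre -[RHS]/0 => <- /=; rewrite -res_map_d.
Qed.

Definition cocycle_map (g : Cocycle i M' N) : Cocycle i M N :=
  exist (fun g => g \in cocyclep i M N) _ (cocycle_map_subproof g).

(* Ext^i_A(phi, N) *)
Definition ext_map (e : Ext i M' N) : Ext i M N :=
  ext_class (cocycle_map (repr e)).

Lemma ext_classE (L : lmodType A) (g h : Cocycle i L N) :
  (ext_class g == ext_class h) = (g - h \in coboundaryp i L N).
Proof. by rewrite Quotient.idealrBE. Qed.

Lemma ext_reprK (L : lmodType A) (e : Ext i L N) : ext_class (repr e) = e.
Proof. exact: reprK. Qed.

Lemma cocycle_mapB g h :
  cocycle_map (g - h) = cocycle_map g - cocycle_map h.
Proof. by apply: val_inj; apply: linear_ext. Qed.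

Lemma ext_map_class g : ext_map (ext_class g) = ext_class (cocycle_map g).
Proof.
apply/eqP; rewrite ext_classE -cocycle_mapB.
have : repr (ext_class g) - g \in coboundaryp i M' N.
  by rewrite -ext_classE /ext_class reprK.
rewrite !unfold_in; move: (_ - g) => {}g /asboolP bg; apply/asboolP.
move: g bg; rewrite /cocycle_map /=; move: cocycle_map_subproof => _.
case: (i) => [|j] g /=; first by move=> ->; rewrite raddf0.
move=> [h <-]; exists (hom_pre (res_map j phi) N h).
apply: linear_ext => x.
by rewrite -[LHS]/(h (res_map j phi (res_d j M x))) -res_map_d.
Qed.

Lemma ext_map_is_zmod_morphism : zmod_morphism ext_map.
Proof.
move=> e f; rewrite -[e]ext_reprK -[f]ext_reprK.
have classB (L : lmodType A) (g h : Cocycle i L N) :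
    ext_class g - ext_class h = ext_class (g - h).
  by rewrite /ext_class [LHS]piE.
by rewrite classB !ext_map_class cocycle_mapB classB.
Qed.
HB.instance Definition _ := GRing.isZmodMorphism.Build
  (Ext i M' N) (Ext i M N) ext_map ext_map_is_zmod_morphism.
End ExtMap.
Arguments ext_map {A} i {M M'} phi N e.

Section Gorenstein.
Variable A : pzRingType.

Definition semi_gorenstein_projective (M : lmodType A) : Prop :=
  forall i : nat, (1 <= i)%N -> forall e : Ext i M A^o, e = 0.

(* The differential d i goes from P i to P (i + 1), so acyclicity at every
   position is exactness at P (i + 1) for all i. *)
Definition acyclic (P : int -> lmodType A)
    (d : forall i, {linear P i -> P (i + 1)}) : Prop :=
  forall i, exact_at (d i) (d (i + 1)).

Definition hom_acyclic (P : int -> lmodType A)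
    (d : forall i, {linear P i -> P (i + 1)}) (Q : lmodType A) : Prop :=
  forall i, exact_at (hom_pre (d (i + 1)) Q) (hom_pre (d i) Q).

Definition gorenstein_projective (G : lmodType A) : Prop :=
  exists (P : int -> lmodType A) (d : forall i, {linear P i -> P (i + 1)}),
    [/\ forall i, fin_gen (P i) /\ projective (P i),
        acyclic d,
        forall Q : lmodType A, fin_gen Q -> projective Q -> hom_acyclic d Q
      & isomorphic G (Ker (d 0))].

Definition left_weakly_gorenstein : Prop :=
  forall M : lmodType A, fin_gen M ->
    semi_gorenstein_projective M -> gorenstein_projective M.

End Gorenstein.

(* Main.v *)
Require Import Defs.
From HB Require Import structures.
From mathcomp Require Import all_boot all_algebra.
From mathcomp Require Import boolp classical_sets.
Import GRing.Theory.
Local Open Scope ring_scope.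

Set Implicit Arguments.
Unset Strict Implicit.
Unset Printing Implicit Defensive.

(** Let [F -> Y] be onto with [F] projective, and let [K] be the pullback of
    [X -> Y <- F], so that [0 -> K -> X * F -> Y -> 0] is exact. The hypotheses
    say that every map [K -> A] comes from a map [F -> A], and that [K] is
    semi-Gorenstein-projective. With [F] finitely generated, [K] is finitely
    generated because [A] is noetherian, so it is Gorenstein-projective, hence
    embeds into a projective and its elements are separated by maps to [A]. If
    [phi x = 0] then [(x, 0)] in [K] is killed by every map from [F], so [x = 0].
    Now [0 -> K -> F -> Coker phi -> 0] is exact and [Coker phi] is
    semi-Gorenstein-projective as well.

    To reach [Ext^i] for all [i] without long exact sequences, the syzygies of
    [K] are taken to be the pullbacks [K n] of [syz n X -> syz n Y <- res n Y],
    and they are compared with those of the standard resolution up to stable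
    retracts. *)

(** * Artin algebras are noetherian *)

Section Span.
Variables (R : pzRingType) (V : lmodType R).
Implicit Types (s t : seq V) (x y v : V) (L : V -> Prop).

Definition submodule L := L 0 /\ forall a x y, L x -> L y -> L (a *: x + y).

Lemma submoduleD L x y : submodule L -> L x -> L y -> L (x + y).
Proof. by move=> [_ h] Lx Ly; rewrite -[x]scale1r; apply: h. Qed.

Lemma submoduleZ L a x : submodule L -> L x -> L (a *: x).
Proof. by move=> [h0 h] Lx; rewrite -[_ *: _]addr0; apply: h. Qed.

Lemma submoduleB L x y : submodule L -> L x -> L y -> L (x - y).
Proof. by move=> [_ h] Lx Ly; rewrite addrC -scaleN1r; apply: h. Qed.

Fixpoint lspan s x : Prop :=
  if s is v :: s' then exists a, lspan s' (x - a *: v) else x = 0.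

Lemma lspan_submodule s : submodule (lspan s).
Proof.
elim: s => [|v s [ih0 ih]]; split=> //=.
- by move=> a x y -> ->; rewrite scaler0 addr0.
- by exists 0; rewrite scale0r subr0.
move=> c x y [a sx] [b sy]; exists (c * a + b).
by rewrite scalerDl -scalerA opprD addrACA -scalerBr; apply: ih.
Qed.

Lemma mem_lspan s v : v \in s -> lspan s v.
Proof.
elim: s => //= w s ih; rewrite inE => /predU1P[->|/ih sv].
  by exists 1; rewrite scale1r subrr; case: (lspan_submodule s).
by exists 0; rewrite scale0r subr0.
Qed.

Lemma lspan_le L s x :
  submodule L -> (forall v, v \in s -> L v) -> lspan s x -> L x.
Proof.
move=> Lsub; elim: s x => [|v s ih] x /= sL; first by case: Lsub => ? _ ->.
move=> [a /ih sx]; rewrite -(subrK (a *: v) x); apply: submoduleD => //.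
  by apply: sx => w ws; apply: sL; rewrite inE ws orbT.
by apply: submoduleZ => //; apply: sL; rewrite mem_head.
Qed.

Lemma lspanP s x :
  lspan s x <-> exists c : 'I_(size s) -> R, x = \sum_(i < size s) c i *: s`_i.
Proof.
split=> [|[c ->]]; last first.
  apply: (@big_ind _ (lspan s)) => [|y z|i _]; first by case: (lspan_submodule s).
    exact: submoduleD (lspan_submodule s).
  by apply: submoduleZ (lspan_submodule s) _; apply/mem_lspan/mem_nth.
elim: s x => [|v s ih] x /=; first by move=> ->; exists (fun=> 0); rewrite big_ord0.
move=> [a /ih[c cE]].
exists (fun i => if unlift ord0 i is Some j then c j else a).
rewrite big_ord_recl unlift_none /=; apply/eqP; rewrite addrC -subr_eq cE.
by apply/eqP/eq_bigr => i _; rewrite liftK.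
Qed.

Definition finitely_spanned L := exists s, forall x, L x <-> lspan s x.

Lemma finitely_spannedT : finitely_spanned setT <-> fin_gen V.
Proof.
split=> -[s sP]; exists s => x; first exact/lspanP/sP.
by split=> // _; apply/lspanP.
Qed.

Definition noetherian := forall L, submodule L -> finitely_spanned L.

End Span.

(* [rho a x] is a linear relation, so that one statement covers both images
   under linear maps and leading coefficients. *)
Lemma finitely_spanned_rel (R : pzRingType) (V W : lmodType R)
  (rho : W -> V -> Prop) (L : V -> Prop) :
  submodule L ->
  rho 0 0 ->
  (forall c a b x y, rho a x -> rho b y -> rho (c *: a + b) (c *: x + y)) ->
  (forall x, L x -> exists a, rho a x) ->
  finitely_spanned (fun a => exists2 x, L x & rho a x) ->
  finitely_spanned (fun x => L x /\ rho 0 x) ->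
  finitely_spanned L.
Proof.
move=> Lsub rho0 rhoP Lrho [t tP] [u uP].
have [w wL wP] : exists2 w : seq V, (forall v, v \in w -> L v) &
    forall a, lspan t a -> exists2 x, lspan w x & rho a x.
  have tJ a : a \in t -> exists2 x, L x & rho a x by move/mem_lspan/tP.
  elim: (t) tJ => [|b t' ih] tJ.
    by exists [::] => // a /= ->; exists 0.
  have [|w wL wP] := ih; first by move=> a at'; apply: tJ; rewrite inE at' orbT.
  have [y Ly by_] := tJ b (mem_head _ _).
  exists (y :: w) => [v|a /= [c /wP[x wx ax]]].
    by rewrite inE => /predU1P[->//|/wL].
  exists (c *: y + x); first by exists c; rewrite addrC addKr.
  by rewrite -(subrK (c *: b) a) addrC; apply: rhoP.
exists (w ++ u) => x; split; last first.
  apply: lspan_le => // v; rewrite mem_cat => /orP[/wL//|/mem_lspan/uP[]//].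
move=> Lx; have [a ax] := Lrho x Lx.
have [y wy ay] : exists2 y, lspan w y & rho a y by apply: wP; apply/tP; exists x.
have Ly : L y by apply: lspan_le wy.
have ssub := lspan_submodule (w ++ u).
rewrite -(subrK y x) addrC; apply: submoduleD => //.
  by apply: lspan_le wy => // v vw; apply: mem_lspan; rewrite mem_cat vw.
have : lspan u (x - y).
  apply/uP; split; first exact: submoduleB.
  have := rhoP (-1) a a _ _ ay ax.
  by rewrite !scaleN1r addNr addrC.
by apply: lspan_le => // v vu; apply: mem_lspan; rewrite mem_cat vu orbT.
Qed.

Lemma finitely_spanned0 (R : pzRingType) (V : lmodType R) (L : V -> Prop) :
  (forall x, L x <-> x = 0) -> finitely_spanned L.
Proof. by exists [::]. Qed.

Lemma finitely_spanned_linear (R : pzRingType) (V W : lmodType R)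
  (f : {linear V -> W}) (L : V -> Prop) :
  submodule L ->
  finitely_spanned (fun a => exists2 x, L x & f x = a) ->
  finitely_spanned (fun x => L x /\ f x = 0) ->
  finitely_spanned L.
Proof.
move=> Lsub; apply: finitely_spanned_rel => //; first exact: linear0.
  by move=> c a b x y <- <-; rewrite linearP.
by move=> x _; exists (f x).
Qed.

Lemma noetherian_inj (R : pzRingType) (V W : lmodType R)
  (f : {linear V -> W}) : injective f -> noetherian W -> noetherian V.
Proof.
move=> finj nW L Lsub; apply: (@finitely_spanned_linear _ _ _ f) => //.
  apply: nW; split=> [|a _ _ [x Lx <-] [y Ly <-]].
    by exists 0; [case: Lsub | rewrite linear0].
  by exists (a *: x + y); [case: Lsub => _; apply | rewrite linearP].
apply: finitely_spanned0 => x; split=> [[_ fx]|->].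
  by apply: finj; rewrite fx linear0.
by split; [case: Lsub | rewrite linear0].
Qed.

Lemma noetherian_fin_gen (R : pzRingType) (V : lmodType R) :
  noetherian R^o -> fin_gen V -> noetherian V.
Proof.
move=> nR /finitely_spannedT[s sP] L Lsub.
have {sP} : forall x, L x -> lspan s x by move=> x _; apply/sP.
elim: s L Lsub => [|v s ih] L Lsub Ls.
  by apply: finitely_spanned0 => x; split=> [/Ls|->] //; case: Lsub.
pose rho (a : R^o) x := lspan s (x - (a : R) *: v).
have rhoP c a b x y : rho a x -> rho b y -> rho (c *: a + b) (c *: x + y).
  rewrite /rho => ax byy; rewrite scalerDl -scalerA opprD addrACA -scalerBr.
  by case: (lspan_submodule s) => _; apply.
have rho0 : rho 0 0.
  by rewrite /rho scale0r subr0; case: (lspan_submodule s).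
apply: (@finitely_spanned_rel _ _ R^o rho) => //.
  apply: nR; split=> [|c a b [x Lx ax] [y Ly byy]].
    by exists 0 => //; case: Lsub.
  by exists (c *: x + y); [case: Lsub => _; apply | exact: rhoP].
apply: ih => [|x [_]]; last by rewrite /rho scale0r subr0.
split=> [|c x y [Lx rx] [Ly ry]]; first by split=> //; case: Lsub.
split; first by case: Lsub => _; apply.
by have := rhoP c 0 0 x y rx ry; rewrite scaler0 addr0.
Qed.

Section Artinian.
Variable R : comPzRingType.
Implicit Types (I J : R^o -> Prop).

Lemma artinian_min (C : (R^o -> Prop) -> Prop) I :
  artinian R -> submodule I -> C I ->
  exists J, [/\ submodule J, C J &
    forall J', submodule J' -> C J' -> (forall x, J' x -> J x) ->
      forall x, J x -> J' x].
Proof.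
move=> hR Isub CI; apply: contrapT => nomin.
pose T := {J | submodule J /\ C J}.
have step (J : T) : exists J' : T,
    (forall x, sval J' x -> sval J x) /\ exists2 x, sval J x & ~ sval J' x.
  case: J => J [Jsub CJ] /=; apply: contrapT => noJ'.
  apply: nomin; exists J; split=> // J' J'sub CJ' J'J x Jx.
  apply: contrapT => nJ'x; apply: noJ'.
  by exists (exist _ J' (conj J'sub CJ')); split; last exists x.
have /choice[next nextP] := step.
pose F n := iter n next (exist _ I (conj Isub CI)).
pose G n : {pred R^o} := fun x => `[< sval (F n) x >].
have GE n x : (x \in G n) = `[< sval (F n) x >] by [].
have [n|n x|n nP] := hR G.
- have [[F0 Flin] _] := svalP (F n).
  split=> [|a x y]; rewrite !GE; first exact/asboolP.
  by move=> /asboolP Fx /asboolP Fy; apply/asboolP/Flin.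
- by rewrite !GE => /asboolP/(proj1 (nextP _))/asboolP.
have [_ [x Fx nFx]] := nextP (F n).
have := nP n.+1 (leqnSn n) x; rewrite !GE => e.
suff : `[< sval (F n.+1) x >] by move=> /asboolP.
by rewrite e; apply/asboolP.
Qed.

Lemma principal_stable (r : R) : artinian R ->
  exists n s, r ^+ n = r ^+ n.+1 * s.
Proof.
move=> hR; pose G n : {pred R^o} := fun x => `[< exists s, x = r ^+ n * s >].
have GE n x : (x \in G n) = `[< exists s, x = r ^+ n * s >] by [].
have [n|n x|n nP] := hR G.
- split=> [|a x y]; rewrite !GE; first by apply/asboolP; exists 0; rewrite mulr0.
  move=> /asboolP[s ->] /asboolP[t ->]; apply/asboolP; exists (a * s + t).
  by rewrite mulrDr /GRing.scale /= mulrCA.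
- by rewrite !GE => /asboolP[s ->]; apply/asboolP; exists (r * s); rewrite exprSr mulrA.
exists n; have := nP n.+1 (leqnSn n) (r ^+ n); rewrite !GE => e.
suff /asboolP : `[< exists s, r ^+ n = r ^+ n.+1 * s >] by [].
by rewrite e; apply/asboolP; exists 1; rewrite mulr1.
Qed.

(* Take a minimal ideal [I] that is not finitely generated. Every [r] either
   kills [I] or satisfies [r I = I], and is then invertible on [I]; so if [J] is
   a submodule of [I] maximal among those avoiding [x], then [I = J + R x]. *)
Lemma artinian_noetherian : artinian R -> noetherian R^o.
Proof.
move=> hR L Lsub; apply: contrapT => Lnfg.
have [I [Isub Infg Imin]] :=
  artinian_min (C := fun I => ~ finitely_spanned I) hR Lsub Lnfg.
have dich (r : R) : (forall x, I x -> r * x = 0) \/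
    (forall x, I x -> exists2 y, I y & r * y = x).
  have flin : linear (fun x : R^o => r * x : R^o).
    by move=> a x y; rewrite mulrDr /GRing.scale /= mulrCA.
  pose f : {linear R^o -> R^o} := HB.pack (fun x : R^o => r * x : R^o)
    (GRing.isLinear.Build R R^o R^o *:%R _ flin).
  have [rfg|rnfg] := pselect (finitely_spanned (fun a => exists2 x, I x & f x = a)).
    left=> x Ix; suff: I x /\ f x = 0 by case.
    apply: (Imin (fun x => I x /\ f x = 0)) Ix => [||y []//].
      split=> [|a y z [Iy fy] [Iz fz]].
        by split; [case: Isub | rewrite linear0].
      by split; [case: Isub => _; apply | rewrite linearP fy fz scaler0 addr0].
    by move=> kfg; apply: Infg; apply: finitely_spanned_linear kfg.
  right=> x Ix; apply: (Imin (fun a => exists2 x, I x & f x = a)) Ix => //.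
    split=> [|a _ _ [y Iy <-] [z Iz <-]].
      by exists 0; [case: Isub | rewrite linear0].
    by exists (a *: y + z); [case: Isub => _; apply | rewrite linearP].
  by move=> _ [y Iy <-]; apply: submoduleZ.
have inv (r y : R) : I y -> r * y <> 0 -> exists s, forall x, I x -> s * (r * x) = x.
  move=> Iy ry; have rI : forall x, I x -> exists2 y, I y & r * y = x.
    by have [r0|//] := dich r; case: ry; apply: r0.
  have [n [s rs]] := principal_stable r hR; exists s => x Ix.
  have {Ix} [z ->] : exists z, x = r ^+ n * z.
    elim: (n) x Ix => [|m ih] x Ix; first by exists x; rewrite mul1r.
    by have [y' /ih[z ->] <-] := rI x Ix; exists z; rewrite exprS mulrA.
  by rewrite [in RHS]rs exprS -!mulrA mulrCA (mulrCA s).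
have [x Ix x0] : exists2 x, I x & x <> 0.
  apply: contrapT => I0; apply: Infg; apply: finitely_spanned0 => x.
  split=> [Ix|->]; last by case: Isub.
  by apply: contrapT => x0; apply: I0; exists x.
(* Closure under [0] is left out of [P] so that the union of the empty chain
   belongs to it. *)
pose P (J : set R^o) := [/\ forall a y z, J y -> J z -> J (a *: y + z),
  forall y, J y -> I y & ~ J x].
have [J [[Jlin JI nJx] Jmax]] : exists J, P J /\ forall B, (J `<` B)%classic -> ~ P B.
  apply: Zorn_bigcup => F FP Ftot; split.
  - move=> a y z [J1 FJ1 J1y] [J2 FJ2 J2z].
    have [J12|J21] := Ftot J1 J2 FJ1 FJ2.
      by exists J2 => //; have [lin _ _] := FP _ FJ2; apply: lin => //; apply: J12.
    by exists J1 => //; have [lin _ _] := FP _ FJ1; apply: lin => //; apply: J21.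
  - by move=> y [K FK Ky]; have [_ KI _] := FP _ FK; apply: KI.
  - by move=> [K FK Kx]; have [_ _] := FP _ FK; apply.
have JP B : P B -> (forall y, J y -> B y) -> forall y, B y -> J y.
  move=> PB JB y By; apply: contrapT => nJy; apply: (Jmax B) PB.
  by split=> // /(_ y By).
have Jsub : submodule J.
  split; last exact: Jlin.
  apply: (JP (fun y => J y \/ y = 0)); [|by left|by right].
  split; last by case=> [/nJx|/x0].
    move=> a y z [Jy|->] [Jz|->].
    - by left; apply: Jlin.
    - by left; apply: (Jlin) => //; rewrite -(addNr y) -scaleN1r; apply: Jlin.
    - by left; rewrite scaler0 add0r.
    - by right; rewrite scaler0 addr0.
  by move=> y [/JI//|->]; case: Isub.
have [s sP] : finitely_spanned J.
  apply: contrapT => Jnfg; apply: nJx; exact: Imin Ix.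
apply: Infg; exists (x :: s) => z; split; last first.
  apply: lspan_le => // v; rewrite inE => /predU1P[->//|/mem_lspan/sP/JI//].
move=> Iz; have [Jz|nJz] := pselect (J z).
  by exists 0; rewrite scale0r subr0; apply/sP.
have [r [j Jj xE]] : exists r, exists2 j, J j & x = r *: z + j.
  apply: contrapT => nx; apply: nJz.
  apply: (JP (fun y => exists r, exists2 j, J j & y = r *: z + j)).
  - split=> // [a _ _ [r1 [j1 J1 ->]] [r2 [j2 J2 ->]]|_ [r [j Jj ->]]].
      exists (a * r1 + r2), (a *: j1 + j2); first exact: Jlin.
      by rewrite scalerDr scalerA scalerDl addrACA.
    by case: Isub => _; apply=> //; apply: JI.
  - by move=> j Jj; exists 0, j => //; rewrite scale0r add0r.
  - by exists 1, 0; [case: Jsub | rewrite scale1r addr0].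
have [|q qP] := inv r z Iz.
  by move=> rz; apply: nJx; rewrite xE /GRing.scale /= rz add0r.
exists q; apply/sP; rewrite xE.
have -> : z - q *: (r *: z + j) = - q *: j.
  by rewrite scalerDr [q *: (r *: z)]qP // opprD addrA subrr add0r scaleNr.
exact: submoduleZ.
Qed.
End Artinian.

Section Restriction.
Variables (R A : pzRingType).

Definition restr (eta : {rmorphism R -> A}) (M : lmodType A) : Type := M.

Variable eta : {rmorphism R -> A}.

Section Lmodule.
Variable M : lmodType A.
HB.instance Definition _ := GRing.Zmodule.on (restr eta M).

Definition restr_scale (r : R) (x : restr eta M) : restr eta M := eta r *: (x : M).

Fact restr_scaleA a b x : restr_scale a (restr_scale b x) = restr_scale (a * b) x.
Proof. by rewrite /restr_scale scalerA rmorphM. Qed.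
Fact restr_scale1 : left_id 1 restr_scale.
Proof. by move=> x; rewrite /restr_scale rmorph1 scale1r. Qed.
Fact restr_scaleDr : right_distributive restr_scale +%R.
Proof. by move=> a x y; rewrite /restr_scale scalerDr. Qed.
Fact restr_scaleDl x : {morph restr_scale^~ x : a b / a + b}.
Proof. by move=> a b; rewrite /restr_scale rmorphD scalerDl. Qed.
HB.instance Definition _ := GRing.Zmodule_isLmodule.Build R (restr eta M)
  restr_scaleA restr_scale1 restr_scaleDr restr_scaleDl.
End Lmodule.

Lemma fin_gen_restr (M : lmodType A) :
  (exists s : seq A, forall a, exists c : 'I_(size s) -> R,
     a = \sum_(i < size s) eta (c i) * s`_i) ->
  fin_gen M -> fin_gen (restr eta M).
Proof.
move=> [s sP] [t tP]; apply/finitely_spannedT.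
pose u : seq (restr eta M) := [seq a *: x | a <- s, x <- t].
have usub := lspan_submodule u.
exists u => x; split=> // _; have [c ->] := tP x.
apply: (@big_ind _ (lspan u)) => [|y z|i _]; first by case: usub.
  exact: submoduleD.
have [b ->] := sP (c i); rewrite scaler_suml.
apply: (@big_ind _ (lspan u)) => [|y z|j _]; first by case: usub.
  exact: submoduleD.
rewrite -scalerA; apply: (@submoduleZ _ (restr eta M) _ _ (s`_j *: t`_i)) => //.
by apply: mem_lspan; apply: allpairs_f; apply: mem_nth.
Qed.

Lemma fin_gen_of_restr (M : lmodType A) : fin_gen (restr eta M) -> fin_gen M.
Proof. by move=> [s sP]; exists s => x; have [c ->] := sP x; exists (eta \o c). Qed.
End Restriction.

Lemma fin_gen_Ker (A : pzRingType) (M N : lmodType A) (f : {linear M -> N}) :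
  artin_algebra A -> fin_gen M -> fin_gen (Ker f).
Proof.
move=> [R [eta [hR _ etaA]]] Mfg; apply: (@fin_gen_of_restr _ _ eta).
have Mnoeth : noetherian (restr eta M).
  apply: noetherian_fin_gen (artinian_noetherian hR) _.
  exact: fin_gen_restr.
have vlin : linear (val : restr eta (Ker f) -> restr eta M) by [].
pose v : {linear restr eta (Ker f) -> restr eta M} :=
  HB.pack (val : restr eta (Ker f) -> restr eta M)
    (GRing.isLinear.Build _ _ _ *:%R _ vlin).
by apply/finitely_spannedT/(noetherian_inj (f := v) val_inj Mnoeth).
Qed.

(** * Stable retracts and extension of maps *)

Section LinearMaps.
Variable A : pzRingType.
Implicit Types L M N P Q X Y Z : lmodType A.

Lemma factor_surj M N P (p : {linear P -> M}) (f : {linear P -> N}) :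
  surj p -> (forall x, p x = 0 -> f x = 0) ->
  exists g : {linear M -> N}, forall x, g (p x) = f x.
Proof.
move=> /choice[s sP] fp; pose g := f \o s.
have gP x : g (p x) = f x.
  by apply/eqP; rewrite -subr_eq0 -linearB fp // linearB sP subrr.
have glin : linear g.
  by move=> a x y; rewrite -(sP x) -(sP y) -linearP !gP linearP.
by exists (HB.pack_for {linear M -> N} g (GRing.isLinear.Build A M N *:%R g glin)).
Qed.

Lemma factor_inj L Q Z (i : {linear L -> Q}) (f : {linear Z -> Q}) :
  injective i -> (forall z, exists l, i l = f z) ->
  exists g : {linear Z -> L}, forall z, i (g z) = f z.
Proof.
move=> iinj /choice[g gP].
have glin : linear g.
  by move=> a x y; apply: iinj; rewrite linearP !gP linearP.
by exists (HB.pack_for {linear Z -> L} g (GRing.isLinear.Build A Z L *:%R g glin)).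
Qed.

Lemma Ker_intro M N (f : {linear M -> N}) x :
  f x = 0 -> exists k : Ker f, val k = x.
Proof.
move=> fx; have xk : x \in kerp f by rewrite unfold_in fx.
by exists (exist _ x xk).
Qed.

Lemma factor_Ker M N Z (f : {linear M -> N}) (g : {linear Z -> M}) :
  (forall z, f (g z) = 0) ->
  exists h : {linear Z -> Ker f}, forall z, val (h z) = g z.
Proof.
move=> fg; apply: (factor_inj (i := val)) => [|z]; first exact: val_inj.
exact: Ker_intro.
Qed.

Lemma Ker_val M N (f : {linear M -> N}) (k : Ker f) : f (val k) = 0.
Proof. exact/eqP/(valP k). Qed.

Definition pairing M N Z (f : {linear Z -> M}) (g : {linear Z -> N}) :
  Z -> M * N := fun z => (f z, g z).
Lemma pairing_is_linear M N Z (f : {linear Z -> M}) (g : {linear Z -> N}) :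
  linear (pairing f g).
Proof. by move=> a x y; rewrite /pairing !linearP. Qed.
HB.instance Definition _ M N Z (f : {linear Z -> M}) (g : {linear Z -> N}) :=
  GRing.isLinear.Build A Z (M * N)%type *:%R (pairing f g) (pairing_is_linear f g).

Definition extendable L Q (i : {linear L -> Q}) N :=
  forall g : {linear L -> N}, exists h : {linear Q -> N}, forall x, h (i x) = g x.

Definition short_exact L Q N (i : {linear L -> Q}) (q : {linear Q -> N}) :=
  [/\ injective i, exact_at i q & surj q].

Lemma projective_prod P Q : projective P -> projective Q -> projective (P * Q)%type.
Proof.
move=> hP hQ M N p f psurj.
pose inl : {linear P -> (P * Q)%type} := pairing idfun \0.
pose inr : {linear Q -> (P * Q)%type} := pairing \0 idfun.
have [g gP] := hP M N p (f \o inl) psurj.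
have [h hP'] := hQ M N p (f \o inr) psurj.
exists ((g \o fst) \+ (h \o snd)) => -[x y] /=.
rewrite linearD [p (g x)]gP [p (h y)]hP' /= -linearD.
by congr (f (_, _)); rewrite /= ?addr0 ?add0r.
Qed.

(* The identity of [M] factors through [N] up to maps factoring through a
   projective: [M] is a direct summand of [N] in the stable category. *)
Definition stable_retract M N := exists (r : {linear M -> N}) (s : {linear N -> M})
    (P : lmodType A) (a : {linear M -> P}) (t : {linear P -> M}),
  projective P /\ forall x, x = s (r x) + t (a x).

Lemma stable_retract_refl M : stable_retract M M.
Proof.
exists idfun, idfun, (Free A void), \0, \0.
by split=> [|x] /=; [exact: free_projective | rewrite addr0].
Qed.

Lemma stable_retract_shift M N L Q L' Q'
  (i : {linear L -> Q}) (q : {linear Q -> M})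
  (i' : {linear L' -> Q'}) (q' : {linear Q' -> N}) :
  short_exact i q -> short_exact i' q' -> projective Q -> projective Q' ->
  stable_retract M N ->
  stable_retract L L' /\ forall B, extendable i' B -> extendable i B.
Proof.
move=> [iinj iq qsurj] [i'inj i'q' q'surj] hQ hQ' [r [s [P [a [t [hP rsP]]]]]].
have [R RP] := hQ _ _ q' (r \o q) q'surj.
have [S SP] := hQ' _ _ q (s \o q') qsurj.
have [T TP] := hP _ _ q t qsurj.
have [R' R'P] : exists R' : {linear L -> L'}, forall l, i' (R' l) = R (i l).
  apply: (factor_inj (f := R \o i)) => // l; apply/i'q'.
  by rewrite [q' _]RP /= (proj2 (iq (i l))) ?linear0 //; exists l.
have [S' S'P] : exists S' : {linear L' -> L}, forall l, i (S' l) = S (i' l).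
  apply: (factor_inj (f := S \o i')) => // l; apply/iq.
  by rewrite [q _]SP /= (proj2 (i'q' (i' l))) ?linear0 //; exists l.
have [U UP] : exists U : {linear Q -> L}, forall x,
    i (U x) = x - S (R x) - T (a (q x)).
  pose u : {linear Q -> Q} := (idfun \- (S \o R)) \- (T \o a \o q).
  apply: (factor_inj (f := u)) => // x; apply/iq.
  rewrite /= !linearB [q (T _)]TP [q (S _)]SP /= [q' (R x)]RP /=.
  by rewrite -addrA -opprD -rsP subrr.
have idL l : l = S' (R' l) + U (i l).
  apply: iinj; rewrite linearD S'P R'P UP (proj2 (iq (i l))); last by exists l.
  by rewrite (linear0 a) (linear0 T) subr0 addrC subrK.
split; first by exists R', S', Q, i, U.
move=> B ext g; have [h hP'] := ext (g \o S').
exists ((h \o R) \+ (g \o U)) => l /=.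
by rewrite -R'P hP' /= -linearD -idL.
Qed.

End LinearMaps.

(** * Ext groups, syzygies and pullbacks *)

Section ExtSyzygy.
Variables (A : pzRingType) (n : nat).
Implicit Types M X Y N : lmodType A.

(* Since [res n.+1 M -> syz n.+1 M] is onto, a cocycle is a map out of
   [syz n.+1 M], and a coboundary one that extends along
   [syz n.+1 M -> res n M]. *)
Lemma cocycle_syzP M N (c : Cocycle n.+1 M N) :
  exists g : {linear syz n.+1 M -> N}, forall x, g (aug _ x) = val c x.
Proof.
apply: (factor_surj (p := aug (syz n.+1 M)) (f := val c)) => [|x x0].
  exact: aug_surj.
have [k kx] : exists k : syz n.+2 M, val k = x := Ker_intro x0.
have [y yk] := aug_surj k.
have := valP c; rewrite unfold_in => /eqP c0.
have := congr1 (fun h : {linear _ -> _} => h y) c0.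
by rewrite /= yk kx.
Qed.

Fact syz_cocycle_subproof M N (g : {linear syz n.+1 M -> N}) :
  hom_pre (aug (syz n.+1 M)) N g \in cocyclep n.+1 M N.
Proof.
rewrite unfold_in; apply/eqP/linear_ext => x /=.
by rewrite Ker_val linear0.
Qed.

Definition syz_cocycle M N (g : {linear syz n.+1 M -> N}) : Cocycle n.+1 M N :=
  exist (fun c => c \in cocyclep n.+1 M N) _ (syz_cocycle_subproof g).

Lemma syz_cocycleE M N (c : Cocycle n.+1 M N) :
  exists g, c = syz_cocycle g.
Proof.
have [g gP] := cocycle_syzP c; exists g; apply: val_inj.
by apply: linear_ext => x /=; rewrite gP.
Qed.

Lemma ext_class_eq0 M N (c : Cocycle n.+1 M N) :
  ext_class c = 0 <-> is_coboundary (val c).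
Proof.
have e0 : ext_class (0 : Cocycle n.+1 M N) = 0 by rewrite /ext_class [RHS]piE.
rewrite -e0; split=> [/eqP|cb].
  by rewrite ext_classE subr0 unfold_in => /asboolP.
by apply/eqP; rewrite ext_classE subr0 unfold_in; apply/asboolP.
Qed.

Lemma syz_coboundaryP M N (g : {linear syz n.+1 M -> N}) :
  is_coboundary (val (syz_cocycle g)) <->
  exists h : {linear res n M -> N}, forall k : syz n.+1 M, h (val k) = g k.
Proof.
split=> [[h hP]|[h hP]]; exists h.
  move=> k; have [x <-] := aug_surj k.
  by have := congr1 (fun f : {linear _ -> _} => f x) hP.
by apply: linear_ext => x /=; rewrite hP.
Qed.

Lemma ext_eq0 M N :
  extendable (val : {linear syz n.+1 M -> res n M}) N ->
  forall e : Ext n.+1 M N, e = 0.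
Proof.
move=> extM e; rewrite -[e]ext_reprK; have [g ->] := syz_cocycleE (repr e).
by apply/ext_class_eq0/syz_coboundaryP.
Qed.

Section Map.
Variables (X Y : lmodType A) (phi : {linear X -> Y}) (N : lmodType A).

Lemma ext_map_syz_cocycle (g : {linear syz n.+1 Y -> N}) :
  ext_map n.+1 phi N (ext_class (syz_cocycle g)) =
  ext_class (syz_cocycle (g \o syz_map n.+1 phi)).
Proof.
rewrite ext_map_class; congr ext_class; apply: val_inj.
by apply: linear_ext => x; rewrite /= free_map_aug.
Qed.

Lemma ext_map_inj (g : {linear syz n.+1 Y -> N}) :
  injective (ext_map n.+1 phi N) ->
  (exists a : {linear res n X -> N}, forall k : syz n.+1 X,
     a (val k) = g (syz_map n.+1 phi k)) ->
  exists b : {linear res n Y -> N}, forall k : syz n.+1 Y, b (val k) = g k.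
Proof.
move=> phi_inj ga; apply/syz_coboundaryP/ext_class_eq0; apply: phi_inj.
by rewrite ext_map_syz_cocycle raddf0; apply/ext_class_eq0/syz_coboundaryP.
Qed.

Lemma ext_map_surj (h : {linear syz n.+1 X -> N}) :
  surj (ext_map n.+1 phi N) ->
  exists (g : {linear syz n.+1 Y -> N}) (a : {linear res n X -> N}),
    forall k : syz n.+1 X, h k = g (syz_map n.+1 phi k) + a (val k).
Proof.
move=> /(_ (ext_class (syz_cocycle h)))[e]; rewrite -[e]ext_reprK.
have [g ->] := syz_cocycleE (repr e).
rewrite ext_map_syz_cocycle => /eqP; rewrite eq_sym ext_classE unfold_in.
have -> : syz_cocycle h - syz_cocycle (g \o syz_map n.+1 phi) =
    syz_cocycle (h \- (g \o syz_map n.+1 phi)).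
  by apply: val_inj; apply: linear_ext.
move=> /asboolP/syz_coboundaryP[a aP]; exists g, a => k.
by rewrite aP /= addrC subrK.
Qed.
End Map.
End ExtSyzygy.

Section ExtVanishing.
Variables (A : pzRingType) (B : lmodType A).

Lemma aug_exact (M : lmodType A) :
  short_exact (val : {linear Ker (aug M) -> Free A M}) (aug M).
Proof.
split; [exact: val_inj | | exact: aug_surj].
by move=> y; split=> [/Ker_intro//|[x <-]]; exact: Ker_val.
Qed.

Lemma ext_eq0_seq (N : nat -> lmodType A) :
  (forall n, exists (Q : lmodType A) (i : {linear N n.+1 -> Q})
     (q : {linear Q -> N n}),
     [/\ short_exact i q, projective Q & extendable i B]) ->
  forall M, stable_retract M (N 0) ->
  forall n (e : Ext n.+1 M B), e = 0.
Proof.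
move=> Nseq M MN n; apply: ext_eq0.
have {MN} syzN m : stable_retract (syz m M) (N m).
  elim: m => [//|m ih]; have [Q [i [q [iq hQ _]]]] := Nseq m.
  exact: (stable_retract_shift (aug_exact (syz m M)) iq
    (@res_projective _ m M) hQ ih).1.
have [Q [i [q [iq hQ iB]]]] := Nseq n.
exact: (stable_retract_shift (aug_exact (syz n M)) iq
  (@res_projective _ n M) hQ (syzN n)).2.
Qed.
End ExtVanishing.

Section Pullback.
Variable A : pzRingType.
Implicit Types X Y Z W P Q S N : lmodType A.

Definition pb X Q Z (f : {linear X -> Z}) (p : {linear Q -> Z}) : lmodType A :=
  Ker ((f \o fst) \- (p \o snd) : {linear (X * Q)%type -> Z}).

Lemma pbE X Q Z (f : {linear X -> Z}) (p : {linear Q -> Z}) (k : pb f p) :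
  f (val k).1 = p (val k).2.
Proof. by apply/eqP; rewrite -subr_eq0; apply/eqP/(Ker_val k). Qed.

Lemma pb_inj X Q Z (f : {linear X -> Z}) (p : {linear Q -> Z}) (k l : pb f p) :
  (val k).1 = (val l).1 -> (val k).2 = (val l).2 -> k = l.
Proof.
have pair_inj (u v : X * Q) : u.1 = v.1 -> u.2 = v.2 -> u = v.
  by case: u v => ? ? [? ?] /= -> ->.
by move=> e1 e2; apply/val_inj/pair_inj.
Qed.

Lemma pb_intro X Q Z (f : {linear X -> Z}) (p : {linear Q -> Z}) x y :
  f x = p y -> exists k : pb f p, val k = (x, y).
Proof.
move=> fp; have k : (x, y) \in kerp ((f \o fst) \- (p \o snd)).
  by rewrite unfold_in /= fp subrr.
by exists (exist _ (x, y) k).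
Qed.

Lemma factor_pb X Q Z W (f : {linear X -> Z}) (p : {linear Q -> Z})
  (g : {linear W -> X}) (h : {linear W -> Q}) :
  (forall w, f (g w) = p (h w)) ->
  exists k : {linear W -> pb f p}, forall w, val (k w) = (g w, h w).
Proof.
move=> fgph.
have [|k kP] := @factor_Ker A (X * Q)%type Z W ((f \o fst) \- (p \o snd)) (pairing g h).
  by move=> w /=; rewrite fgph subrr.
by exists k.
Qed.

Lemma pb_exact X Z X1 Z1 P Q S (f : {linear X -> Z}) (f1 : {linear X1 -> Z1})
  (F : {linear P -> Q}) (iX : {linear X1 -> P}) (p : {linear P -> X})
  (iZ : {linear Z1 -> Q}) (q : {linear Q -> Z}) (s : {linear S -> Z1}) :
  short_exact iX p -> short_exact iZ q -> surj s ->
  (forall x, q (F x) = f (p x)) -> (forall x, iZ (f1 x) = F (iX x)) ->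
  exists (i : {linear pb f1 s -> (P * S)%type})
         (r : {linear (P * S)%type -> pb f q}),
    short_exact i r /\ forall k, i k = (iX (val k).1, (val k).2).
Proof.
move=> [iXinj iXp psurj] [iZinj iZq qsurj] ssurj Fq Fi.
have qiZ z : q (iZ z) = 0 by apply/iZq; exists z.
have piX x : p (iX x) = 0 by apply/iXp; exists x.
have [i iP] : exists i : {linear pb f1 s -> (P * S)%type},
    forall k, i k = (iX (val k).1, (val k).2).
  pose v : {linear pb f1 s -> (X1 * S)%type} := val.
  by exists (pairing (iX \o fst \o v) (snd \o v)).
have [r rP] : exists r : {linear (P * S)%type -> pb f q},
    forall a b, val (r (a, b)) = (p a, F a - iZ (s b)).
  have [|r rP] := factor_pb (f := f) (p := q) (g := p \o fst)
      (h := (F \o fst) \- (iZ \o s \o snd)).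
    by move=> [a b] /=; rewrite linearB Fq qiZ subr0.
  by exists r => a b; rewrite rP.
exists i, r; split=> //; split.
- move=> k l; rewrite !iP => -[/iXinj e1 e2].
  exact: pb_inj.
- move=> [a b]; split=> [rab|[k]]; last first.
    rewrite iP => -[<- <-]; apply: val_inj; rewrite rP piX -Fi.
    by rewrite pbE subrr.
  have := rP a b; rewrite rab => -[/esym/iXp[x ax] /esym/eqP].
  rewrite subr_eq0 -ax -Fi => /eqP/iZinj e.
  by have [k kP] := pb_intro e; exists k; rewrite iP kP /= ax.
- move=> k; have [a aP] := psurj (val k).1.
  have [|z zP] := (iZq (F a - (val k).2)).1.
    by rewrite linearB Fq aP pbE subrr.
  have [b bP] := ssurj z.
  exists (a, b); apply: val_inj; rewrite rP bP zP aP subKr.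
  by case: (val k).
Qed.

Lemma pb_hom X Z N (f : {linear X -> Z}) (g : {linear pb f (aug Z) -> N}) :
  (forall g : {linear Ker (aug Z) -> N},
     (exists a : {linear Free A X -> N},
        forall k : Ker (aug X), a (val k) = g (ker_map f k)) ->
     exists b : {linear Free A Z -> N}, forall k : Ker (aug Z), b (val k) = g k) ->
  exists (h : {linear X -> N}) (b : {linear Free A Z -> N}),
    forall k, g k = h (val k).1 + b (val k).2.
Proof.
move=> Hinj.
have [|j jP] := @factor_pb X (Free A Z) Z (Ker (aug Z)) f (aug Z) \0 val.
  by move=> k /=; rewrite linear0 Ker_val.
have [|l lP] := @factor_pb X (Free A Z) Z (Free A X) f (aug Z) (aug X) (free_map A f).
  by move=> k /=; rewrite free_map_aug.
have [|b bP] := Hinj (g \o j).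
  exists (g \o l) => k /=; congr (g _); apply: val_inj.
  by rewrite lP jP Ker_val.
pose v : {linear pb f (aug Z) -> (X * Free A Z)%type} := val.
have [||h hP] := factor_surj (p := fst \o v) (f := g \- (b \o snd \o v)).
- move=> x; have [a ax] := aug_surj x.
  by exists (l a); rewrite /= /v lP.
- move=> k /= k0.
  have [|k' k'E] := Ker_intro (f := aug Z) (x := (val k).2).
    by rewrite -pbE [X in f X]k0 linear0.
  have -> : k = j k'.
    by apply: pb_inj; rewrite jP.
  by have /= <- := bP k'; rewrite jP /= subrr.
by exists h, b => k; rewrite hP /= subrK.
Qed.

Lemma pb_step X Z N (f : {linear X -> Z}) :
  (forall g : {linear Ker (aug (Ker (aug Z))) -> N},
     (exists a : {linear Free A (Ker (aug X)) -> N},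
        forall k : Ker (aug (Ker (aug X))), a (val k) = g (ker_map (ker_map f) k)) ->
     exists b : {linear Free A (Ker (aug Z)) -> N},
       forall k : Ker (aug (Ker (aug Z))), b (val k) = g k) ->
  (forall h : {linear Ker (aug X) -> N},
     exists (g : {linear Ker (aug Z) -> N}) (a : {linear Free A X -> N}),
       forall k : Ker (aug X), h k = g (ker_map f k) + a (val k)) ->
  exists (Q : lmodType A) (i : {linear pb (ker_map f) (aug (Ker (aug Z))) -> Q})
    (q : {linear Q -> pb f (aug Z)}),
    [/\ short_exact i q, projective Q & extendable i N].
Proof.
move=> Hinj Hsurj.
have [|i [q [iq iE]]] := @pb_exact X Z (Ker (aug X)) (Ker (aug Z))
    (Free A X) (Free A Z) (Free A (Ker (aug Z))) f (ker_map f) (free_map A f)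
    _ _ _ _ _ (aug_exact X) (aug_exact Z) (@aug_surj _ (Ker (aug Z))) (free_map_aug f).
  by [].
exists (Free A X * Free A (Ker (aug Z)))%type, i, q; split=> // [|g].
  by apply: projective_prod; exact: free_projective.
have [h [b hbE]] := pb_hom g Hinj; have [c [a caE]] := Hsurj h.
pose b' : {linear Free A (Ker (aug Z)) -> N} := (c \o aug _) \+ b.
exists ((a \o fst) \+ (b' \o snd)) => k.
rewrite iE hbE caE /= addrA; congr (_ + _); rewrite addrC; congr (_ + _).
by congr (c _); exact: esym (pbE k).
Qed.
End Pullback.

Section PullbackSequence.
Variables (A : pzRingType) (X Y : lmodType A) (phi : {linear X -> Y}).
Variable N : lmodType A.
Hypothesis ext_bij : forall i, (1 <= i)%N -> bijective (ext_map i phi N).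
Hypothesis hom_surj : surj (hom_pre phi N).

Let K n := pb (syz_map n phi) (aug (syz n Y)).

Lemma ext_map_bij_inj n (g : {linear syz n.+1 Y -> N}) :
  (exists a : {linear res n X -> N}, forall k : syz n.+1 X,
     a (val k) = g (syz_map n.+1 phi k)) ->
  exists b : {linear res n Y -> N}, forall k : syz n.+1 Y, b (val k) = g k.
Proof. by apply: ext_map_inj; exact: bij_inj (@ext_bij n.+1 isT). Qed.

Lemma ext_map_bij_surj n (h : {linear syz n.+1 X -> N}) :
  exists (g : {linear syz n.+1 Y -> N}) (a : {linear res n X -> N}),
    forall k : syz n.+1 X, h k = g (syz_map n.+1 phi k) + a (val k).
Proof.
apply: ext_map_surj => y; have [e _ eK] := @ext_bij n.+1 isT.
by exists (e y).
Qed.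

Lemma pb_hom_free (g : {linear pb phi (aug Y) -> N}) :
  exists b : {linear Free A Y -> N}, forall k, g k = b (val k).2.
Proof.
have [h [b hbE]] := pb_hom g (@ext_map_bij_inj 0); have [c cE] := hom_surj h.
exists ((c \o aug Y) \+ b) => k /=.
rewrite hbE -[h]cE /=; congr (_ + _).
by have /= <- := pbE k.
Qed.

Lemma pb_syz_step n : exists (Q : lmodType A) (i : {linear K n.+1 -> Q})
  (q : {linear Q -> K n}),
  [/\ short_exact i q, projective Q & extendable i N].
Proof. exact: pb_step (@ext_map_bij_inj n.+1) (@ext_map_bij_surj n). Qed.
End PullbackSequence.

(** * Finite generation and torsionless modules *)

Lemma fin_gen_free (A : pzRingType) (T : finType) : fin_gen (Free A T).
Proof.
apply/finitely_spannedT; exists [seq free_gen A t | t : T] => f; split=> // _.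
rewrite -[f]free_genE (@free_liftE _ _ _ _ _ (enum T)) ?enum_uniq //; last first.
  by move=> t _; rewrite mem_enum.
have usub := lspan_submodule [seq free_gen A t | t : T].
apply: (@big_ind _ (lspan [seq free_gen A t | t : T])) => [|x y|t _].
- by case: usub.
- exact: submoduleD.
- by apply: submoduleZ => //; apply/mem_lspan/codom_f.
Qed.

Lemma fin_gen_prod (A : pzRingType) (M N : lmodType A) :
  fin_gen M -> fin_gen N -> fin_gen (M * N)%type.
Proof.
move=> [s sP] [t tP]; apply/finitely_spannedT.
pose u : seq (M * N) := [seq (x, 0) | x <- s] ++ [seq (0, y) | y <- t].
exists u => -[x y]; split=> // _; have usub := lspan_submodule u.
have -> : (x, y) = (x, 0) + (0, y) :> M * N.
  by congr (_, _); rewrite /= ?addr0 ?add0r.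
have [c ->] := sP x; have [d ->] := tP y.
apply: submoduleD => //.
  have -> : (\sum_(i < size s) c i *: s`_i, 0) =
      \sum_(i < size s) c i *: (s`_i, 0 : N) :> M * N.
    apply: (big_rec2 (fun a b => (a, 0) = b)) => // i z1 z2 _ <-.
    by congr (_, _); rewrite /= scaler0 addr0.
  apply: (@big_ind _ (lspan u)) => [|z w|i _]; first by case: usub.
    exact: submoduleD.
  apply: submoduleZ => //; apply: mem_lspan; rewrite mem_cat map_f //.
  exact: mem_nth.
have -> : (0, \sum_(i < size t) d i *: t`_i) =
    \sum_(i < size t) d i *: (0 : M, t`_i) :> M * N.
  apply: (big_rec2 (fun a b => (0, a) = b)) => // i z1 z2 _ <-.
  by congr (_, _); rewrite /= scaler0 addr0.
apply: (@big_ind _ (lspan u)) => [|z w|i _]; first by case: usub.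
  exact: submoduleD.
apply: submoduleZ => //; apply: mem_lspan; rewrite mem_cat orbC map_f //.
exact: mem_nth.
Qed.

Lemma fin_gen_cover (A : pzRingType) (M : lmodType A) : fin_gen M ->
  exists (F : lmodType A) (p : {linear F -> M}),
    [/\ fin_gen F, projective F & surj p].
Proof.
move=> [s sP]; exists (Free A 'I_(size s)), (free_lift (fun i => s`_(val i))).
split; [exact: fin_gen_free | exact: free_projective | move=> x].
have [c ->] := sP x; exists (\sum_i c i *: free_gen A i).
by rewrite linear_sum; apply: eq_bigr => i _; rewrite linearZ /= free_lift_gen.
Qed.

Lemma fin_gen_surj (A : pzRingType) (M N : lmodType A) (f : {linear M -> N}) :
  surj f -> fin_gen M -> fin_gen N.
Proof.
move=> fsurj [s sP]; exists (map f s) => y; have [x <-] := fsurj y.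
have [c ->] := sP x; rewrite size_map; exists c.
by rewrite linear_sum; apply: eq_bigr => i _; rewrite linearZ /= (nth_map 0).
Qed.

Lemma projective_torsionless (A : pzRingType) (P : lmodType A) (x : P) :
  projective P -> (forall g : {linear P -> A^o}, g x = 0) -> x = 0.
Proof.
move=> hP x0.
have [s sP] := hP _ _ (aug P) idfun (@aug_surj _ _).
rewrite -[x]sP -[RHS](linear0 (aug P)) /=; congr (aug P _).
apply/val_inj/funext => y.
have evlin : linear (fun f : Free A P => val f y) by [].
pose ev : {linear Free A P -> A^o} :=
  HB.pack_for {linear Free A P -> A^o} (fun f : Free A P => val f y)
    (GRing.isLinear.Build A _ A^o *:%R _ evlin).
exact: x0 (ev \o s).
Qed.

Lemma gorenstein_projective_torsionless (A : pzRingType) (G : lmodType A) (x : G) :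
  gorenstein_projective G -> (forall g : {linear G -> A^o}, g x = 0) -> x = 0.
Proof.
move=> [P [d [hP _ _ [f fbij]]]] x0.
apply: (bij_inj fbij); apply: val_inj; rewrite linear0.
apply: (projective_torsionless (hP 0).2) => g.
exact: x0 (g \o (val : {linear Ker (d 0) -> P 0}) \o f).
Qed.

(** * The pullback and the cokernel *)

Lemma pb_stable_retract (A : pzRingType) (X P Q Z : lmodType A)
  (f : {linear X -> Z}) (p : {linear P -> Z}) (q : {linear Q -> Z}) :
  projective P -> projective Q -> surj p -> surj q ->
  stable_retract (pb f p) (pb f q).
Proof.
move=> hP hQ psurj qsurj.
have [u uP] := hP _ _ q p qsurj; have [v vP] := hQ _ _ p q psurj.
pose vp : {linear pb f p -> (X * P)%type} := val.
pose vq : {linear pb f q -> (X * Q)%type} := val.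
have [|r rP] := @factor_pb A X Q Z (pb f p) f q (fst \o vp) (u \o snd \o vp).
  by move=> k; rewrite [RHS]uP; exact: pbE.
have [|s sP] := @factor_pb A X P Z (pb f q) f p (fst \o vq) (v \o snd \o vq).
  by move=> k; rewrite [RHS]vP; exact: pbE.
have [|t tP] := @factor_pb A X P Z P f p \0 (idfun \- (v \o u)).
  by move=> y /=; rewrite linear0 linearB [p (v _)]vP [q _]uP subrr.
exists r, s, P, (snd \o vp), t; split=> // k.
have sE : val (s (r k)) = ((val k).1, v (u (val k).2)) by rewrite sP /= /vq rP.
apply: pb_inj; rewrite linearD /= sE tP /= ?addr0 //.
by rewrite /vp addrC subrK.
Qed.

Section Cokernel.
Variables (A : pzRingType) (X Y : lmodType A) (phi : {linear X -> Y}).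

Lemma coker_pi_is_linear : linear (coker_pi phi).
Proof. by move=> a x y; rewrite coker_piD coker_piZ. Qed.
HB.instance Definition _ :=
  GRing.isLinear.Build A Y (Coker phi) *:%R (coker_pi phi) coker_pi_is_linear.

Lemma coker_pi_eq0 y : coker_pi phi y = 0 <-> exists x, phi x = y.
Proof.
rewrite -[0](linear0 (coker_pi phi)); split=> [/eqP|yP].
  by rewrite coker_piE subr0 unfold_in => /asboolP.
by apply/eqP; rewrite coker_piE subr0 unfold_in; apply/asboolP.
Qed.

Lemma coker_pi_surj : surj (coker_pi phi).
Proof. by move=> c; exists (repr c); exact: coker_reprK. Qed.

Lemma pb_coker_exact (Q : lmodType A) (q : {linear Q -> Y}) :
  injective phi -> surj q ->
  exists (i : {linear pb phi q -> Q}) (p : {linear Q -> Coker phi}),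
    short_exact i p /\ forall k, i k = (val k).2.
Proof.
move=> phi_inj qsurj; pose v : {linear pb phi q -> (X * Q)%type} := val.
have [i iE] : exists i : {linear pb phi q -> Q}, forall k, i k = (val k).2.
  by exists (snd \o v).
exists i, (coker_pi phi \o q); split=> //; split.
- move=> k l; rewrite !iE => kl; apply: pb_inj => //; apply: phi_inj.
  by rewrite !pbE kl.
- move=> y; split=> [/coker_pi_eq0[x xy]|[k <-]].
    by have [k kE] := pb_intro xy; exists k; rewrite iE kE.
  by apply/coker_pi_eq0; exists (val k).1; rewrite iE pbE.
- move=> c; have [y <-] := coker_pi_surj c; have [x <-] := qsurj y.
  by exists x.
Qed.
End Cokernel.

Theorem theorem1p5 (A : pzRingType) (hA : artin_algebra A)
  (hG : left_weakly_gorenstein A)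
  (X Y : lmodType A) (hX : fin_gen X) (hY : fin_gen Y)
  (phi : {linear X -> Y})
  (hHom : surj (hom_pre phi A^o))
  (hExt : forall i : nat, (1 <= i)%N -> bijective (ext_map i phi A^o)) :
  injective phi /\ gorenstein_projective (Coker phi).
Proof.
pose K n := pb (syz_map n phi) (aug (syz n Y)).
have Kstep := @pb_syz_step A X Y phi A^o hExt.
have Khom := @pb_hom_free A X Y phi A^o hExt hHom.
have [F [p [Ffg hF psurj]]] := fin_gen_cover hY.
have K'ret := pb_stable_retract phi hF (@free_projective A Y) psurj (@aug_surj A Y).
have phi_inj : injective phi.
  have K'gp : gorenstein_projective (pb phi p).
    apply: hG => [|[//|n] _]; last exact: (@ext_eq0_seq _ _ K) K'ret _.
    by apply: fin_gen_Ker => //; apply: fin_gen_prod.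
  suff ker0 x : phi x = 0 -> x = 0.
    by move=> x y xy; apply/eqP; rewrite -subr_eq0 (ker0 (x - y)) // linearB xy subrr.
  move=> x0.
  have [k kE] : exists k : pb phi p, val k = (x, 0).
    by apply: pb_intro; rewrite linear0.
  suff k0 : k = 0 by move: kE; rewrite k0 => /(congr1 fst) /= <-.
  apply: gorenstein_projective_torsionless K'gp _ => g.
  have [v vP] := @free_projective A Y _ _ p (aug Y) psurj.
  pose val' : {linear pb phi (aug Y) -> (X * Free A Y)%type} := val.
  have [|s sP] := @factor_pb A X F Y _ phi p (fst \o val') (v \o snd \o val').
    by move=> l; rewrite [RHS]vP; exact: pbE.
  have [b bE] := Khom (g \o s).
  have [l lE] : exists l : pb phi (aug Y), val l = (x, 0).
    by apply: pb_intro; rewrite linear0.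
  have -> : k = s l by apply: val_inj; rewrite sP kE /= /val' lE /= linear0.
  by rewrite -[LHS]/((g \o s) l) bE lE linear0.
split=> //; apply: hG => [|[//|n] _].
  by apply: fin_gen_surj hY; exact: coker_pi_surj.
apply: (@ext_eq0_seq _ _ (fun n => if n is m.+1 then K m else Coker phi)).
  case=> [|m]; last exact: Kstep.
  have [i [q [iq iE]]] := pb_coker_exact phi_inj (@aug_surj A Y).
  exists (Free A Y), i, q; split=> // [|g]; first exact: free_projective.
  by have [b bE] := Khom g; exists b => k; rewrite bE iE.
exact: stable_retract_refl.
Qed.
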